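(* Let $a,b\in\mathbb{Q}$. For every integer $n\ge 0$, the Hankel transform $(h_n)_{n\ge 0}$ of the sequence $(aC_{n+3}+bC_{n+4})_{n\ge 0}$ is given by $$h_n=[x^{n+1}]\left(\frac{(1-b^2x^2)(1+(a+6b)x+b^2x^2)}{(1-bx)^8},\ \frac{x}{(1-bx)^2}\right)\cdot\frac{1}{(1-ax)^4}.$$
   Context: $C_n=\frac{1}{n+1}\binom{2n}{n}$ denotes the $n$-th Catalan number ($1,1,2,5,14,\ldots$). The Hankel transform of a sequence $(s_n)_{n\ge 0}$ is the sequence $(h_n)_{n\ge 0}$ with $h_n=\det(s_{i+j})_{0\le i,j\le n}$. $[x^m]F(x)$ denotes the coefficient of $x^m$ in the formal power series $F(x)$. A Riordan array is a pair $(g,f)$ of formal power series in $\mathbb{Q}[[x]]$ with $g(0)\neq 0$, $f(0)=0$, $f'(0)\ne 0$; it acts on a power series $h$ by $(g,f)\cdot h=g(x)\,h(f(x))$. *)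

(* Defs.v *)
(* MathComp. Equality and choice on power series are classical, hence boolp. *)
From HB Require Import structures.
From mathcomp Require Import all_boot all_order all_algebra.
From mathcomp Require Import boolp.

Set Implicit Arguments.
Unset Strict Implicit.
Unset Printing Implicit Defensive.

Import GRing.Theory.
Local Open Scope ring_scope.

(* A wrapper around nat -> F rather than nat -> F itself, which has the
   pointwise ring structure. *)
Record fps (F : Type) : Type := Fps { fps_coef : nat -> F }.

Lemma fpsP (F : Type) (p q : fps F) :
  (forall n, fps_coef p n = fps_coef q n) -> p = q.
Proof. by case: p q => [p] [q] /= pq; congr Fps; apply/funext. Qed.

HB.instance Definition _ (F : Type) := gen_eqMixin (fps F).
HB.instance Definition _ (F : Type) := gen_choiceMixin (fps F).

Section FpsRing.
Variable F : fieldType.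
Implicit Types p q r : fps F.

Definition fps_zero : fps F := Fps (fun=> 0).
Definition fps_opp p : fps F := Fps (fun n => - fps_coef p n).
Definition fps_add p q : fps F := Fps (fun n => fps_coef p n + fps_coef q n).
Definition fps_one : fps F := Fps (fun n => (n == 0)%:R).
Definition fps_mul p q : fps F :=
  Fps (fun n => \sum_(i < n.+1) fps_coef p i * fps_coef q (n - i)%N).
Definition fps_scale (c : F) p : fps F := Fps (fun n => c * fps_coef p n).

Lemma fps_addA : associative fps_add.
Proof. by move=> p q r; apply: fpsP => n /=; rewrite addrA. Qed.
Lemma fps_addC : commutative fps_add.
Proof. by move=> p q; apply: fpsP => n /=; rewrite addrC. Qed.
Lemma fps_add0 : left_id fps_zero fps_add.
Proof. by move=> p; apply: fpsP => n /=; rewrite add0r. Qed.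
Lemma fps_addN : left_inverse fps_zero fps_opp fps_add.
Proof. by move=> p; apply: fpsP => n /=; rewrite addNr. Qed.

HB.instance Definition _ :=
  GRing.isZmodule.Build (fps F) fps_addA fps_addC fps_add0 fps_addN.

Definition fps_trunc n p : {poly F} := \poly_(i < n.+1) fps_coef p i.

Lemma coef_fps_trunc n p i :
  (i <= n)%N -> (fps_trunc n p)`_i = fps_coef p i.
Proof. by move=> le_in; rewrite coef_poly ltnS le_in. Qed.

Lemma fps_coef_mul n p q i : (i <= n)%N ->
  fps_coef (fps_mul p q) i = (fps_trunc n p * fps_trunc n q)`_i.
Proof.
move=> le_in; rewrite coefM /=; apply: eq_bigr => j _.
have le_ji : (j <= i)%N by rewrite -ltnS.
rewrite !coef_fps_trunc //; first exact: leq_trans (leq_subr _ _) le_in.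
exact: leq_trans le_ji le_in.
Qed.

Lemma fps_mulA : associative fps_mul.
Proof.
move=> p q r; apply: fpsP => n.
transitivity (fps_trunc n p * (fps_trunc n q * fps_trunc n r))`_n.
  rewrite coefM; apply: eq_bigr => i _.
  by rewrite coef_fps_trunc ?(@fps_coef_mul n) ?leq_subr // leq_ord.
rewrite mulrA coefM; apply: eq_bigr => i _.
by rewrite (@fps_coef_mul n) ?coef_fps_trunc ?leq_subr // leq_ord.
Qed.

Lemma fps_mulC : commutative fps_mul.
Proof. by move=> p q; apply: fpsP => n; rewrite !(@fps_coef_mul n) // mulrC. Qed.

Lemma fps_mul1 : left_id fps_one fps_mul.
Proof.
move=> p; apply: fpsP => n /=.
by rewrite big_ord_recl /= mul1r subn0 big1 ?addr0 // => i _; rewrite mul0r.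
Qed.

Lemma fps_mulDl : left_distributive fps_mul fps_add.
Proof.
move=> p q r; apply: fpsP => n /=.
by rewrite -big_split; apply: eq_bigr => i _; rewrite mulrDl.
Qed.

Lemma fps_oner_neq0 : fps_one != 0.
Proof.
apply/eqP => /(congr1 (fun p => fps_coef p 0)) /= /eqP.
by rewrite (oner_eq0 F).
Qed.

HB.instance Definition _ :=
  GRing.Zmodule_isComNzRing.Build (fps F)
    fps_mulA fps_mulC fps_mul1 fps_mulDl fps_oner_neq0.

Lemma fps_scaleA c d p : fps_scale c (fps_scale d p) = fps_scale (c * d) p.
Proof. by apply: fpsP => n /=; rewrite mulrA. Qed.
Lemma fps_scale1 : left_id 1 fps_scale.
Proof. by move=> p; apply: fpsP => n /=; rewrite mul1r. Qed.
Lemma fps_scaleDr : right_distributive fps_scale +%R.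
Proof. by move=> c p q; apply: fpsP => n /=; rewrite mulrDr. Qed.
Lemma fps_scaleDl p : {morph fps_scale^~ p : c d / c + d}.
Proof. by move=> c d; apply: fpsP => n /=; rewrite mulrDl. Qed.

HB.instance Definition _ :=
  GRing.Zmodule_isLmodule.Build F (fps F)
    fps_scaleA fps_scale1 fps_scaleDr fps_scaleDl.

Lemma fps_scaleAl (c : F) p q : c *: (p * q) = (c *: p) * q.
Proof.
apply: fpsP => n /=; rewrite mulr_sumr.
by apply: eq_bigr => i _; rewrite mulrA.
Qed.

HB.instance Definition _ := GRing.Lmodule_isLalgebra.Build F (fps F) fps_scaleAl.
HB.instance Definition _ := GRing.Lalgebra_isComAlgebra.Build F (fps F).

(* The first n.+1 coefficients of 1/p, from
   p_0 q_n = - \sum_(i < n) q_i p_(n - i). *)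
Fixpoint fps_inv_seq p n : seq F :=
  if n is m.+1 then
    let s := fps_inv_seq p m in
    rcons s (- (fps_coef p 0)^-1 *
              \sum_(i < m.+1) nth 0 s i * fps_coef p (m.+1 - i)%N)
  else [:: (fps_coef p 0)^-1].

Definition fps_unit : {pred fps F} := fun p => fps_coef p 0 != 0.

Definition fps_inv p : fps F :=
  if fps_unit p then Fps (fun n => nth 0 (fps_inv_seq p n) n) else p.

Lemma size_fps_inv_seq p n : size (fps_inv_seq p n) = n.+1.
Proof. by elim: n => //= n IHn; rewrite size_rcons IHn. Qed.

Lemma nth_fps_inv_seq p n i : (i <= n)%N ->
  nth 0 (fps_inv_seq p n) i = nth 0 (fps_inv_seq p i) i.
Proof.
elim: n => [|n IHn]; first by case: i.
rewrite leq_eqVlt => /predU1P[->//|lt_in].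
by rewrite /= nth_rcons size_fps_inv_seq lt_in IHn.
Qed.

Lemma fps_mulVr : {in fps_unit, left_inverse 1 fps_inv *%R}.
Proof.
move=> p p0; have p0' : fps_coef p 0 != 0 by [].
apply: fpsP => n; rewrite /fps_inv ifT //=.
case: n => [|n]; first by rewrite big_ord1 mulVf.
rewrite big_ord_recr /= subnn nth_rcons size_fps_inv_seq ltnn eqxx.
rewrite mulNr mulNr mulrAC mulVf // mul1r; apply/eqP; rewrite subr_eq0; apply/eqP.
by apply: eq_bigr => i _; rewrite -(@nth_fps_inv_seq p n) // -ltnS.
Qed.

Lemma fps_unitPl p q : q * p = 1 -> fps_unit p.
Proof.
move/(congr1 (fun r => fps_coef r 0)); rewrite /= big_ord1 /= => /eqP.
by apply: contraTneq => ->; rewrite mulr0 eq_sym oner_eq0.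
Qed.

Lemma fps_inv_out : {in [predC fps_unit], fps_inv =1 id}.
Proof.
by move=> p; rewrite inE /= unfold_in /fps_inv /fps_unit => /negbTE ->.
Qed.

HB.instance Definition _ :=
  GRing.ComNzRing_hasMulInverse.Build (fps F) fps_mulVr fps_unitPl fps_inv_out.

Definition fpsX : fps F := Fps (fun n => (n == 1)%:R).

(* h(f(x)), meaningful for f(0) = 0: then f^k has no term of degree less
   than k, so only the k <= n contribute to the coefficient of degree n. *)
Definition fps_comp (h f : fps F) : fps F :=
  Fps (fun n => \sum_(k < n.+1) fps_coef h k * fps_coef (f ^+ k) n).

(* The condition f'(0) != 0 is on the coefficient of degree 1. *)
Record riordan : Type := Riordan {
  riordan_g : fps F;
  riordan_f : fps F;
  riordan_g_neq0 : fps_coef riordan_g 0 != 0;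
  riordan_f_eq0 : fps_coef riordan_f 0 = 0;
  riordan_f'_neq0 : fps_coef riordan_f 1 != 0 }.

Definition riordan_act (A : riordan) (h : fps F) : fps F :=
  riordan_g A * fps_comp h (riordan_f A).

Lemma fps_coef1 n : fps_coef (1 : fps F) n = (n == 0)%:R. Proof. by []. Qed.
Lemma fps_coefX n : fps_coef fpsX n = (n == 1)%:R. Proof. by []. Qed.
Lemma fps_coefD p q n : fps_coef (p + q) n = fps_coef p n + fps_coef q n.
Proof. by []. Qed.
Lemma fps_coefB p q n : fps_coef (p - q) n = fps_coef p n - fps_coef q n.
Proof. by []. Qed.
Lemma fps_coefZ c p n : fps_coef (c *: p) n = c * fps_coef p n.
Proof. by []. Qed.
Lemma fps_coefM p q n :
  fps_coef (p * q) n = \sum_(i < n.+1) fps_coef p i * fps_coef q (n - i)%N.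
Proof. by []. Qed.

Lemma fps_coef01 : fps_coef (1 : fps F) 0 = 1. Proof. by []. Qed.
Lemma fps_coef0X : fps_coef fpsX 0 = 0 :> F. Proof. by []. Qed.

Lemma fps_coef0M p q : fps_coef (p * q) 0 = fps_coef p 0 * fps_coef q 0.
Proof. by rewrite fps_coefM big_ord1. Qed.

Lemma fps_coef0Xn p n : fps_coef (p ^+ n) 0 = fps_coef p 0 ^+ n.
Proof. by elim: n => // n IHn; rewrite !exprS fps_coef0M IHn. Qed.

Lemma fps_coef0V p : fps_coef p^-1 0 = (fps_coef p 0)^-1.
Proof.
change (fps_coef (fps_inv p) 0 = (fps_coef p 0)^-1).
by rewrite /fps_inv /fps_unit; case: eqP => //= ->; rewrite invr0.
Qed.

Definition fps_coef0E :=
  (fps_coef0M, fps_coef0V, fps_coef0Xn, fps_coefB, fps_coefD, fps_coefZ,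
   fps_coef0X, fps_coef01).

Lemma array_g_neq0 (a b : F) :
  fps_coef ((1 - b ^+ 2 *: fpsX ^+ 2)
              * (1 + (a + 6%:R * b) *: fpsX + b ^+ 2 *: fpsX ^+ 2)
              / (1 - b *: fpsX) ^+ 8) 0 != 0.
Proof.
rewrite !fps_coef0E expr0n !mulr0 subr0 !addr0 !mulr1 invr1 mulr1.
exact: oner_neq0.
Qed.

Lemma array_f_eq0 (b : F) : fps_coef (fpsX / (1 - b *: fpsX) ^+ 2) 0 = 0.
Proof. by rewrite fps_coef0M fps_coefX mul0r. Qed.

Lemma array_f'_neq0 (b : F) :
  fps_coef (fpsX / (1 - b *: fpsX) ^+ 2) 1 != 0.
Proof.
rewrite fps_coefM big_ord_recl big_ord1 !fps_coefX mul0r add0r mul1r subnn.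
by rewrite !fps_coef0E mulr0 subr0 mulr1 invr1 oner_neq0.
Qed.

End FpsRing.

Arguments fpsX {F}.

Definition catalan (n : nat) : rat := n.+1%:R^-1 * 'C(2 * n, n)%:R.

Definition hankel (R : comNzRingType) (s : nat -> R) (n : nat) : R :=
  \det (\matrix_(i < n.+1, j < n.+1) s (i + j)%N).

(* Main.v *)
Require Import Defs.
From mathcomp Require Import all_boot all_order all_algebra.
From mathcomp Require Import ring zify.

Set Implicit Arguments.
Unset Strict Implicit.

Import GRing.Theory Num.Theory.
Local Open Scope ring_scope.

(** Both sides satisfy the same three-term recurrence in n.

    Determinant side.  The numbers C_(m+3) are the moments of a functional
    whose orthogonal polynomials satisfy a three-term recurrence with explicit
    rational coefficients ([alpha], [beta]; squared norms [sqnorm]).  Writing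
    A for the matrix of t^m in the basis of these polynomials ([stieltjes]),
    the Hankel matrix of a C_(m+3) + b C_(m+4) is A J A^T, with A unitriangular
    and J the tridiagonal Gram matrix of the weight multiplied by a + b t
    ([hankel_stieltjes]).  So the Hankel transform is a determinant of a
    tridiagonal matrix, and expanding along the last row gives a recurrence
    ([det_tridiagSS]).  That recurrence is free of divisions, so it covers the
    pairs (a, b) for which some minors vanish.

    The explicit coefficients come from the weight of C_(m+1), whose orthogonal
    polynomials are Chebyshev polynomials of the second kind in t/2 - 1, with
    Jacobi matrix J1 having 2 on the diagonal and 1 beside it.  Multiplying the
    weight by t^2 replaces the identity Gram matrix by J1^2, and the LDL^T
    factorization of the pentadiagonal matrix J1^2 has rational entries:
    its diagonal part is [sqnorm], and L expresses A through the ballot numbers.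

    Series side.  With q = 1 - (a + 2b) x + b^2 x^2, the substitution makes the
    powers of 1 - b x cancel, and the series becomes
      F = (1 - b^2 x^2) (1 + (a + 6b) x + b^2 x^2) / q^4
    ([riordan_series]).  Since (x / q)' = (1 - b^2 x^2) / q^2 and
    1 + (a + 6b) x + b^2 x^2 = q + 2 (a + 4b) x, the series x F is the
    derivative of y^2 / 2 + 2 (a + 4b) y^3 / 3 for y = x / q, so its
    coefficients are those of 1 / q^2 and x / q^3 up to simple factors
    ([riordan_coef]).  These two coefficient sequences determine each other by a
    first-order system ([coef_Xq3S], [coef_q2S]), which reduces the recurrence
    for F to an identity of rational functions ([riordan_closedSS]). *)

(** * Tridiagonal determinants *)

Section Tridiagonal.
Variable R : comNzRingType.

(** Entries are sums of three mutually exclusive terms, so that a product with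
    a vector splits by linearity. *)
Definition tridiag (d e : nat -> R) (n : nat) : 'M[R]_n :=
  \matrix_(i < n, j < n)
    ((if (j == i :> nat)%N then d i else 0)
     + (if (j == i.+1 :> nat)%N then e i else 0)
     + (if (i == j.+1 :> nat)%N then e j else 0)).

Lemma tridiag_diag (d e : nat -> R) n (i j : 'I_n) :
  j = i :> nat -> tridiag d e n i j = d i.
Proof. by rewrite mxE => ->; rewrite eqxx (ltn_eqF (ltnSn i)) !addr0. Qed.

Lemma tridiag_up (d e : nat -> R) n (i j : 'I_n) :
  j = i.+1 :> nat -> tridiag d e n i j = e i.
Proof.
rewrite mxE => ->; rewrite eqxx (gtn_eqF (ltnSn i)) (ltn_eqF (leqnSn i.+1)).
by rewrite add0r addr0.
Qed.

Lemma tridiag_sym (d e : nat -> R) n (i j : 'I_n) :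
  tridiag d e n i j = tridiag d e n j i.
Proof.
by rewrite !mxE addrAC eq_sym; congr (_ + _ + _); case: eqP => // ->.
Qed.

Lemma tridiag0 (d e : nat -> R) n (i j : 'I_n) :
  (i.+1 < j)%N -> tridiag d e n i j = 0.
Proof.
move=> lt_ij; rewrite mxE (gtn_eqF lt_ij) (gtn_eqF (ltnW lt_ij)).
by rewrite (ltn_eqF (leqW (ltnW lt_ij))) !addr0.
Qed.

(** The vanishing of x at n absorbs the entry of the infinite matrix that the
    truncation to size n cuts off in the last row. *)
Lemma tridiag_row (d e x : nat -> R) (n : nat) (i : 'I_n) : x n = 0 ->
  \sum_(j < n) tridiag d e n i j * x j =
    d i * x i + e i * x i.+1 + (if i : nat is k.+1 then e k * x k else 0).
Proof.
move=> xn0.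
under eq_bigr => j _ do rewrite mxE !mulrDl !(fun_if ( *%R^~ _)) !mul0r.
rewrite !big_split /= -!big_mkcond /=; congr (_ + _ + _).
- by rewrite (big_ord1_eq _ (fun j => d i * x j)) ltn_ord.
- rewrite (big_ord1_eq _ (fun j => e i * x j)); case: ltnP => // le_ni.
  have -> : i.+1 = n by apply/eqP; rewrite eqn_leq ltn_ord.
  by rewrite xn0 mulr0.
case: i => [[|k] lt_kn] /=; first by rewrite big_pred0.
under eq_bigl => j do rewrite eqSS eq_sym.
by rewrite (big_ord1_eq _ (fun j => e j * x j)) (ltnW lt_kn).
Qed.

Lemma det_tridiagSS (d e : nat -> R) n :
  \det (tridiag d e n.+2) =
    d n.+1 * \det (tridiag d e n.+1) - e n ^+ 2 * \det (tridiag d e n).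
Proof.
rewrite (expand_det_row _ ord_max) big_ord_recr /= big_ord_recr /=.
rewrite big1 => [|i _]; last first.
  by rewrite tridiag_sym tridiag0 ?mul0r //= !ltnS.
rewrite add0r addrC tridiag_diag //; congr (_ * _ + _).
  rewrite /cofactor -signr_odd oddD addbb mul1r.
  congr (\det _); apply/matrixP => i j; rewrite !mxE /= /bump.
  by rewrite (leqNgt n.+1 i) (leqNgt n.+1 j) !ltn_ord.
rewrite [tridiag _ _ _ _ _]tridiag_sym tridiag_up // expr2 -mulrA -mulrN.
congr (_ * _).
rewrite /cofactor -signr_odd oddD /= addNb addbb expr1 mulN1r; congr (- _).
(* The last column of the remaining minor is zero except for its bottom entry. *)
rewrite (expand_det_col _ ord_max) big_ord_recr /= big1 => [|i _]; last first.
  rewrite 2![fun_of_matrix _ _ _]mxE tridiag0 ?mul0r //=.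
  have lt_in := ltn_ord i.
  by rewrite /= /bump leqnn (leqNgt n.+1 i) ltnS (ltnW lt_in).
rewrite add0r; congr (_ * _).
  rewrite 2![fun_of_matrix _ _ _]mxE tridiag_up /= /bump ?leqnn;
  by rewrite leqNgt ltnSn.
rewrite /cofactor /= -signr_odd oddD addbb mul1r.
congr (\det _); apply/matrixP => i j; rewrite !mxE /= /bump.
have hi := ltn_ord i; have hj := ltn_ord j.
by rewrite (ltn_geF hi) (ltn_geF hj) !add0n (ltn_geF hj) (ltn_geF (leqW hi)).
Qed.

End Tridiagonal.

(** * Hankel matrices and Stieltjes matrices *)

Section Stieltjes.
Variables (R : comNzRingType) (alpha beta D : nat -> R) (A : nat -> nat -> R).
Hypothesis A0 : forall k, A 0 k = (k == 0)%:R.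
Hypothesis AS0 : forall n, A n.+1 0 = alpha 0 * A n 0 + beta 0 * A n 1.
Hypothesis ASS : forall n k,
  A n.+1 k.+1 = A n k + alpha k.+1 * A n k.+1 + beta k.+1 * A n k.+2.
Hypothesis DS : forall k, D k.+1 = beta k * D k.

Lemma stieltjes_trig n k : (n < k)%N -> A n k = 0.
Proof.
elim: n k => [|n IHn] [|k] // lt_nk.
by rewrite ASS !IHn ?mulr0 ?addr0 //; lia.
Qed.

Lemma stieltjes_diag n : A n n = 1.
Proof.
elim: n => [|n IHn]; first by rewrite A0 eqxx.
by rewrite ASS IHn !stieltjes_trig ?mulr0 ?addr0.
Qed.

(** The Gram matrix of the monic orthogonal polynomials, of squared norms D,
    for the weight multiplied by a + b t. *)
Definition jacobi a b :=
  tridiag (fun k => D k * (a + b * alpha k)) (fun k => b * D k.+1).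

Lemma jacobi_row a b N i (k : 'I_N) : (i < N)%N ->
  \sum_(l < N) jacobi a b N k l * A i l = D k * (a * A i k + b * A i.+1 k).
Proof.
move=> lt_iN; rewrite (@tridiag_row _ _ _ (A i)); last exact: stieltjes_trig.
by case: k => [[|k] lt_kN] /=; rewrite ?AS0 ?ASS !DS; ring.
Qed.

(** The inner product of t^i and t^j, computed on their coordinates. *)
Let S N i j := \sum_(k < N) A i k * (D k * A j k).

(** Multiplication by t is self-adjoint, because its matrix [jacobi 0 1] is
    symmetric. *)
Lemma stieltjes_gramS N i j :
  (i < N)%N -> (j < N)%N -> S N i.+1 j = S N i j.+1.
Proof.
have row m (k : 'I_N) : (m < N)%N ->
    D k * A m.+1 k = \sum_(l < N) jacobi 0 1 N k l * A m l.
  by move=> lt_mN; rewrite jacobi_row // mul0r add0r mul1r.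
move=> lt_iN lt_jN; rewrite /S.
under eq_bigr => k _ do rewrite mulrA [_ * D k]mulrC row // mulr_suml.
rewrite exchange_big /=; apply: eq_bigr => k _.
rewrite row // mulr_sumr; apply: eq_bigr => l _.
by rewrite [jacobi _ _ _ l k]tridiag_sym; ring.
Qed.

Lemma stieltjes_gram N i j : (i < N)%N -> S N i j = D 0 * A (i + j) 0.
Proof.
(* Self-adjointness moves t^i to the right factor one step at a time; this
   needs room for t^(i + j), and the bound is lowered afterwards. *)
have big N' : (i + j < N')%N -> S N' i j = D 0 * A (i + j) 0.
  elim: i j => [|i' IHi] j' lt_N.
    rewrite /S; case: N' lt_N => // N' _.
    rewrite big_ord_recl A0 mul1r big1 ?addr0 // => k _.
    by rewrite A0 mul0r.
  by rewrite stieltjes_gramS ?IHi ?addnS; lia || by [].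
move=> lt_iN; rewrite -(big (maxn N (i + j).+1)) ?leq_maxr //.
rewrite /S (big_ord_widen _ (fun k => A i k * (D k * A j k))
                          (leq_maxl N (i + j).+1)).
rewrite big_mkcond; apply: eq_bigr => k _; case: ltnP => // le_Nk.
by rewrite stieltjes_trig ?mul0r //; lia.
Qed.

(** Congruence by the unitriangular matrix A, which keeps the determinant; the
    truncations to size n + 1 multiply like the infinite matrices because A is
    lower triangular. *)
Lemma hankel_stieltjes a b n :
  hankel (fun m => a * (D 0 * A m 0) + b * (D 0 * A m.+1 0)) n =
  \det (jacobi a b n.+1).
Proof.
pose L : 'M[R]_n.+1 := \matrix_(i, k) A i k.
have detL : \det L = 1.
  rewrite det_trig ?big1 => [//|i _|]; first by rewrite mxE stieltjes_diag.
  by apply/is_trig_mxP => i j lt_ij; rewrite mxE stieltjes_trig.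
rewrite /hankel.
suff -> : \matrix_(i < n.+1, j < n.+1)
    (a * (D 0 * A (i + j) 0) + b * (D 0 * A (i + j).+1 0)) =
    L *m (jacobi a b n.+1 *m L^T).
  by rewrite !det_mulmx det_tr detL mul1r mulr1.
apply/matrixP => i j; rewrite !mxE -addnS -!(@stieltjes_gram n.+1) //.
rewrite !mulr_sumr -big_split /=; apply: eq_bigr => k _; rewrite !mxE.
under eq_bigr => l _ do rewrite [L^T _ _]mxE [L _ _]mxE.
by rewrite jacobi_row //; ring.
Qed.

End Stieltjes.

(** * The Stieltjes matrix of the shifted Catalan numbers *)

(** By the reflection principle, the number of Dyck prefixes of length 2n + 1
    ending at height 2k + 1.  These are the entries of the Stieltjes matrix of
    the sequence C_(n+1). *)
Definition ballot (n k : nat) : rat :=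
  'C(n.*2.+1, n + k.+1)%:R - 'C(n.*2.+1, n + k.+2)%:R.

Lemma binSS m k : 'C(m.+2, k.+2) = ('C(m, k.+2) + 'C(m, k.+1).*2 + 'C(m, k))%N.
Proof. by rewrite !binS -addnn -!addnA. Qed.

Lemma bin_middle n : 'C(n.*2.+1, n) = 'C(n.*2.+1, n.+1).
Proof. by rewrite -bin_sub; [congr 'C(_, _); lia | lia]. Qed.

Lemma ballot0 k : ballot 0 k = (k == 0)%:R.
Proof.
case: k => [|k]; first exact/eqP.
by rewrite /ballot !bin_small ?subrr.
Qed.

Lemma ballotSS n k :
  ballot n.+1 k.+1 = ballot n k + 2 * ballot n k.+1 + ballot n k.+2.
Proof.
rewrite /ballot doubleS !addSn !addnS; move: n.*2.+1 => m.
rewrite !binSS -!muln2 !natrD !natrM; ring.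
Qed.

Lemma ballotS0 n : ballot n.+1 0 = 2 * ballot n 0 + ballot n 1.
Proof.
have := bin_middle n; rewrite /ballot doubleS !addSn !addnS !addn0.
move: n.*2.+1 => m E; rewrite !binSS E -!muln2 !natrD !natrM; ring.
Qed.

Lemma catalan_ballot n : catalan n.+1 = ballot n 0.
Proof.
have /(congr1 (fun m => m%:R : rat)) := mul_bin_left n.*2.+1 n.+1.
have -> : (n.*2.+1 - n.+1 = n)%N by lia.
rewrite !natrM => E; rewrite /catalan /ballot mul2n doubleS binS !addnS addn0.
rewrite bin_middle; move: n.*2.+1 E => m E.
have n2 : n.+2%:R != 0 :> rat by rewrite pnatr_eq0.
apply: (mulfI n2); rewrite mulVKf // mulrBr E natrD -!natr1; ring.
Qed.

(** The pivots of the LDL^T factorization of J1^2.  They are also the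
    quotients of consecutive Hankel determinants of C_(m+3), which are the
    values (k + 1) (k + 2) (2k + 3) / 6 (sums of squares). *)
Definition sqnorm k : rat :=
  (k%:R + 3) * (2 * k%:R + 5) / ((k%:R + 1) * (2 * k%:R + 3)).

(** For L the factor of J1^2, the matrix L^-1 J1 L is again tridiagonal, and
    [alpha k] = 2 + L (k + 1) k - L k (k - 1) is its diagonal. *)
Definition alpha k : rat := 2 + 12 / ((2 * k%:R + 3) * (2 * k%:R + 5)).

Definition beta k : rat := sqnorm k.+1 / sqnorm k.

(** Right multiplication of the ballot matrix by the factor L of J1^2. *)
Definition stieltjes n k : rat :=
  ballot n k + 4 * (k%:R + 1) / (2 * k%:R + 5) * ballot n k.+1
    + (sqnorm k)^-1 * ballot n k.+2.

(* Affine expressions in a natural number with a positive constant term. *)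
Ltac affine_neq0 := repeat (apply/andP; split);
  by rewrite ?(natr1, =^~natrM, =^~natrD) pnatr_eq0 ?addnS.

Lemma sqnorm_neq0 k : sqnorm k != 0.
Proof.
by rewrite /sqnorm mulf_neq0 ?invr_eq0 ?mulf_neq0 //; affine_neq0.
Qed.

Lemma stieltjes0 k : stieltjes 0 k = (k == 0)%:R.
Proof. by rewrite /stieltjes !ballot0 !mulr0 !addr0. Qed.

Lemma stieltjesS0 n :
  stieltjes n.+1 0 = alpha 0 * stieltjes n 0 + beta 0 * stieltjes n 1.
Proof.
by rewrite /stieltjes ballotS0 !ballotSS /beta /alpha /sqnorm; field.
Qed.

Lemma stieltjesSS n k :
  stieltjes n.+1 k.+1 =
    stieltjes n k + alpha k.+1 * stieltjes n k.+1 + beta k.+1 * stieltjes n k.+2.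
Proof.
rewrite /stieltjes !ballotSS /beta /alpha /sqnorm.
rewrite -![k.+1%:R]natr1 -![k.+2%:R]natr1 -![k.+1%:R]natr1; field.
affine_neq0.
Qed.

Lemma sqnormS k : sqnorm k.+1 = beta k * sqnorm k.
Proof. by rewrite /beta divfK // sqnorm_neq0. Qed.

Lemma catalan_stieltjes m : catalan (m + 3) = sqnorm 0 * stieltjes m 0.
Proof.
by rewrite addn3 catalan_ballot !ballotS0 ballotSS /stieltjes /sqnorm; field.
Qed.

(** * Substitution and derivation of power series *)

Section FpsTheory.
Variable F : fieldType.
Implicit Types p q f h : fps F.

Lemma fps_unitE p : (p \is a GRing.unit) = (fps_coef p 0 != 0).
Proof. by []. Qed.

Lemma fps_coefXM0 p : fps_coef (fpsX * p) 0 = 0.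
Proof. by rewrite fps_coef0M fps_coef0X mul0r. Qed.

Lemma fps_coefXMS p n : fps_coef (fpsX * p) n.+1 = fps_coef p n.
Proof.
rewrite fps_coefM !big_ord_recl /= mul0r add0r mul1r subSS subn0.
by rewrite big1 ?addr0 // => i _; rewrite mul0r.
Qed.

Lemma fps_coef_expr_lt f k n :
  fps_coef f 0 = 0 -> (n < k)%N -> fps_coef (f ^+ k) n = 0.
Proof.
move=> f0; elim: k n => // k IHk n lt_nk.
rewrite exprS fps_coefM big_ord_recl f0 mul0r add0r.
by rewrite big1 // => i _; rewrite IHk ?mulr0 // lift0; have := ltn_ord i; lia.
Qed.

Lemma fps_coef_comp h f n : fps_coef (fps_comp h f) n =
  \sum_(k < n.+1) fps_coef h k * fps_coef (f ^+ k) n.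
Proof. by []. Qed.

Lemma fps_comp1 f : fps_comp 1 f = 1.
Proof.
apply: fpsP => n /=; rewrite big_ord_recl /= mul1r big1 ?addr0 // => i _.
by rewrite mul0r.
Qed.

Lemma fps_compXM f p :
  fps_coef f 0 = 0 -> fps_comp (fpsX * p) f = f * fps_comp p f.
Proof.
move=> f0; apply: fpsP => n.
transitivity (\sum_(k < n.+1) fps_coef p k * fps_coef (f ^+ k.+1) n).
  rewrite [RHS]big_ord_recr [fps_coef (f ^+ ord_max.+1) _]fps_coef_expr_lt //.
  rewrite mulr0 [RHS]addr0 fps_coef_comp big_ord_recl (fps_coefXM0 p).
  rewrite mul0r add0r.
  by apply: eq_bigr => k _; rewrite lift0 fps_coefXMS.
under eq_bigr => k _ do rewrite exprS fps_coefM mulr_sumr.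
rewrite exchange_big fps_coefM; apply: eq_bigr => i _ /=.
rewrite mulr_sumr (big_ord_widen n.+1
  (fun k => fps_coef f i * (fps_coef p k * fps_coef (f ^+ k) (n - i))));
  last by rewrite ltnS leq_subr.
rewrite [RHS]big_mkcond; apply: eq_bigr => k _.
case: ltnP => [_|lt_k]; first by rewrite mulrCA.
by rewrite fps_coef_expr_lt // !mulr0.
Qed.

Lemma fps_comp_linM f p a : fps_coef f 0 = 0 ->
  fps_comp ((1 - a *: fpsX) * p) f = (1 - a *: f) * fps_comp p f.
Proof.
move=> f0; rewrite !mulrBl !mul1r -!scalerAl -fps_compXM //.
apply: fpsP => n; rewrite fps_coefB fps_coefZ /= mulr_sumr -sumrB.
by apply: eq_bigr => k _; rewrite mulrBl mulrA.
Qed.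

(** By induction on m, removing one linear factor 1 - a x at a time. *)
Lemma fps_comp_linXV f a m : fps_coef f 0 = 0 ->
  fps_comp ((1 - a *: fpsX) ^+ m)^-1 f = ((1 - a *: f) ^+ m)^-1.
Proof.
have u p : fps_coef p 0 = 0 -> (1 - a *: p) \is a GRing.unit.
  by move=> p0; rewrite fps_unitE fps_coefB fps_coefZ p0 mulr0 subr0 oner_eq0.
move=> f0; apply: (mulrI (unitrX m (u _ f0))); rewrite mulrV ?unitrX ?u //.
elim: m => [|m IHm]; first by rewrite !expr0 mul1r invr1 fps_comp1.
rewrite exprSr -mulrA -fps_comp_linM // exprS invrM ?unitrX ?u //.
by rewrite [(_ ^+ m)^-1 * _]mulrC mulVKr ?u.
Qed.

(** Turning scalings into products by constant series puts identities within
    the reach of commutative ring normalization.  A name separate from c%:A is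
    needed since c%:A is itself a scaling. *)
Definition fpsC (c : F) : fps F := c%:A.

Lemma fpsCD c d : fpsC (c + d) = fpsC c + fpsC d.
Proof. exact: (rmorphD (in_alg (fps F))). Qed.
Lemma fpsCN c : fpsC (- c) = - fpsC c.
Proof. exact: (rmorphN (in_alg (fps F))). Qed.
Lemma fpsCM c d : fpsC (c * d) = fpsC c * fpsC d.
Proof. exact: (rmorphM (in_alg (fps F))). Qed.
Lemma fpsCX c n : fpsC (c ^+ n) = fpsC c ^+ n.
Proof. exact: (rmorphXn (in_alg (fps F))). Qed.
Lemma fpsC_nat n : fpsC n%:R = n%:R.
Proof. exact: (rmorph_nat (in_alg (fps F))). Qed.
Lemma fps_scaleC c p : c *: p = fpsC c * p.
Proof. by rewrite mulr_algl. Qed.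

Definition fpsCE := (fpsC_nat, fpsCX, fps_scaleC, fpsCD, fpsCN, fpsCM).

Definition fps_deriv p : fps F := Fps (fun n => n.+1%:R * fps_coef p n.+1).

Lemma fps_derivM p q :
  fps_deriv (p * q) = fps_deriv p * q + p * fps_deriv q.
Proof.
apply: fpsP => n; rewrite fps_coefD !fps_coefM /= mulr_sumr.
transitivity (\sum_(i < n.+2) (i%:R * fps_coef p i * fps_coef q (n.+1 - i)
   + fps_coef p i * ((n.+1 - i)%:R * fps_coef q (n.+1 - i)%N))).
  apply: eq_bigr => i _; rewrite -{1}(subnKC (leq_ord i)) natrD; ring.
rewrite big_split /=; congr (_ + _).
  by rewrite big_ord_recl !mul0r add0r.
rewrite big_ord_recr /= subnn mul0r mulr0 addr0; apply: eq_bigr => i _.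
by rewrite subSn // -ltnS.
Qed.

Lemma fps_derivD p q : fps_deriv (p + q) = fps_deriv p + fps_deriv q.
Proof. by apply: fpsP => n /=; rewrite mulrDr. Qed.

Lemma fps_derivZ a p : fps_deriv (a *: p) = a *: fps_deriv p.
Proof. by apply: fpsP => n /=; rewrite mulrCA. Qed.

Lemma fps_deriv1 : fps_deriv 1 = 0.
Proof. by apply: fpsP => n /=; rewrite mulr0. Qed.

Lemma fps_derivX : fps_deriv fpsX = 1.
Proof. by apply: fpsP => -[|n] /=; rewrite ?mulr1 ?mulr0. Qed.

Lemma fps_derivV p :
  p \is a GRing.unit -> fps_deriv p^-1 = - fps_deriv p * p^-1 ^+ 2.
Proof.
move=> up; have := fps_derivM p p^-1; rewrite mulrV // fps_deriv1 => E.
apply: (mulrI up); rewrite expr2 mulrCA mulVKr //.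
by apply/eqP; rewrite -subr_eq0 mulNr opprK addrC -E.
Qed.

Lemma fps_coefX_deriv p n :
  fps_coef (fpsX * fps_deriv p) n = n%:R * fps_coef p n.
Proof.
by case: n => [|n]; rewrite ?fps_coefXM0 ?fps_coefXMS ?mul0r.
Qed.

End FpsTheory.

(** * The generating function of the right-hand side *)

Section Series.
Variables a b : rat.
Local Notation X := fpsX.
Local Notation a' := (fpsC a).
Local Notation b' := (fpsC b).

Definition quad : fps rat := 1 - (a + 2 * b) *: X + b ^+ 2 *: X ^+ 2.

(** The coefficients of [quad_inv2] and [X_quad_inv3] are homogenized
    Gegenbauer polynomials of parameters 2 and 3, the latter shifted by one. *)
Definition quad_inv2 := (quad ^+ 2)^-1.
Definition X_quad_inv3 := X / quad ^+ 3.

Lemma quad_unit : quad \is a GRing.unit.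
Proof. by rewrite fps_unitE !fps_coef0E !mulr0 subr0 addr0 oner_eq0. Qed.

Lemma quadE : quad = 1 - (a' + 2 * b') * X + b' ^+ 2 * X ^+ 2.
Proof. by rewrite /quad !fpsCE. Qed.

Lemma deriv_quad : fps_deriv quad = - (a' + 2 * b') + 2 * b' ^+ 2 * X.
Proof.
rewrite /quad expr2 -scaleNr !fps_derivD !fps_derivZ fps_derivM.
rewrite fps_deriv1 !fps_derivX !fpsCE; ring.
Qed.

(** Brings different powers of 1 / q to a common one, which makes identities
    in q and 1 / q polynomial. *)
Lemma quadVX j k : quad^-1 ^+ k = quad ^+ j * quad^-1 ^+ (j + k).
Proof.
by rewrite exprD mulrA -exprMn mulrV ?quad_unit // expr1n mul1r.
Qed.

Lemma coef_Xq3_inv n :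
  fps_coef X_quad_inv3 n.+1 = fps_coef (quad^-1 ^+ 3) n.
Proof. by rewrite /X_quad_inv3 fps_coefXMS exprVn. Qed.

(** The coefficient form of 4 / q^3 = x (1 / q^2)' + 4 / q^2 + 2 (a + 2b) x / q^3,
    which says that 4 - 2 (a + 2b) x = 4 q - 2 x q'. *)
Lemma coef_Xq3S n :
  4 * fps_coef X_quad_inv3 n.+1 =
    (n%:R + 4) * fps_coef quad_inv2 n
      + 2 * (a + 2 * b) * fps_coef X_quad_inv3 n.
Proof.
have E : 4%:R *: quad^-1 ^+ 3 =
    X * fps_deriv quad_inv2 + 4%:R *: quad_inv2
      + (2 * (a + 2 * b)) *: X_quad_inv3.
  rewrite /X_quad_inv3 /quad_inv2 -!exprVn expr2 fps_derivM.
  rewrite fps_derivV ?quad_unit // deriv_quad !fpsCE.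
  set u : fps rat := quad^-1.
  have u2 : u ^+ 2 = quad * u ^+ 3 by exact: (quadVX 1 2).
  transitivity ((2 * (a' + 2 * b') * X
    - 2 * X * (- (a' + 2 * b') + 2 * b' ^+ 2 * X)) * u ^+ 3 + 4 * u ^+ 2).
    rewrite u2 quadE; ring.
  ring.
rewrite coef_Xq3_inv -fps_coefZ E !fps_coefD !fps_coefZ fps_coefX_deriv; ring.
Qed.

(** The coefficient form of (1 / q^2)' = - 2 q' / q^3. *)
Lemma coef_q2S n :
  (n%:R + 1) * fps_coef quad_inv2 n.+1 =
    2 * (a + 2 * b) * fps_coef X_quad_inv3 n.+1
      - 4 * b ^+ 2 * fps_coef X_quad_inv3 n.
Proof.
have E : fps_deriv quad_inv2 =
    (2 * (a + 2 * b)) *: quad^-1 ^+ 3 - (4 * b ^+ 2) *: X_quad_inv3.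
  rewrite /X_quad_inv3 /quad_inv2 -!exprVn expr2 fps_derivM.
  rewrite fps_derivV ?quad_unit // deriv_quad !fpsCE; ring.
have -> : (n%:R + 1) * fps_coef quad_inv2 n.+1 =
    fps_coef (fps_deriv quad_inv2) n by rewrite natr1.
by rewrite E fps_coefB !fps_coefZ coef_Xq3_inv.
Qed.

Definition riordan_closed (n : nat) : rat :=
  (n%:R + 2) / 6 * (3 * fps_coef quad_inv2 n
                      + 4 * (a + 4 * b) * fps_coef X_quad_inv3 n).

(** With p = 1 / (2 q^2) + 2 (a + 4b) x / (3 q^3), the series H is
    x p' + 2 p = (x^2 p)' / x.  The proof clears denominators by a factor 6. *)
Lemma riordan_coef (H : fps rat) n :
  H * quad ^+ 4 =
    (1 - b ^+ 2 *: X ^+ 2) * (1 + (a + 6%:R * b) *: X + b ^+2 *: X ^+ 2) ->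
  fps_coef H n = riordan_closed n.
Proof.
move=> HE.
pose p := 3%:R *: quad_inv2 + (4 * (a + 4 * b)) *: X_quad_inv3.
have E : 6%:R *: H = X * fps_deriv p + 2%:R *: p; last first.
  have : 6%:R * fps_coef H n =
      (n%:R + 2) * (3 * fps_coef quad_inv2 n
                      + 4 * (a + 4 * b) * fps_coef X_quad_inv3 n).
    by rewrite -fps_coefZ E fps_coefD fps_coefX_deriv !fps_coefZ -mulrDl.
  by move=> E6; rewrite /riordan_closed mulrAC -E6; field.
have -> : H = (1 - b' ^+ 2 * X ^+ 2)
    * (1 + (a' + 6 * b') * X + b' ^+2 * X^+2) * quad^-1 ^+ 4.
  transitivity (H * quad ^+ 4 * quad^-1 ^+ 4).
    by rewrite -mulrA -exprMn mulrV ?quad_unit // expr1n mulr1.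
  by rewrite HE !fpsCE.
rewrite /p fps_derivD !fps_derivZ /quad_inv2 /X_quad_inv3 -!exprVn.
rewrite expr2 exprSr expr2 !fps_derivM fps_derivX fps_derivV ?quad_unit //.
rewrite !fpsCE; set u : fps rat := quad^-1; set dq := fps_deriv quad.
have u2 : u ^+ 2 = quad ^+ 2 * u ^+ 4 by exact: (quadVX 2 2).
have u3 : u ^+ 3 = quad * u ^+ 4 by exact: (quadVX 1 3).
transitivity (6 * u ^+ 2 + (12 * (a' + 4 * b') * X - 6 * X * dq) * u ^+ 3
    - 12 * (a' + 4 * b') * X ^+ 2 * dq * u ^+ 4).
  rewrite u2 u3 /dq deriv_quad quadE; ring.
ring.
Qed.

(** For f = x / (1 - b x)^2, the factor (1 - a f)^4 of the denominator is
    (q / (1 - b x)^2)^4, whose powers of 1 - b x cancel. *)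
Lemma riordan_series :
  ((1 - b ^+ 2 *: fpsX ^+ 2)
     * (1 + (a + 6%:R * b) *: fpsX + b ^+ 2 *: fpsX ^+ 2)
     / (1 - b *: fpsX) ^+ 8)
    * fps_comp ((1 - a *: fpsX) ^+ 4)^-1 (fpsX / (1 - b *: fpsX) ^+ 2)
    * quad ^+ 4
  = (1 - b ^+ 2 *: fpsX ^+ 2)
     * (1 + (a + 6%:R * b) *: fpsX + b ^+ 2 *: fpsX ^+ 2).
Proof.
rewrite fps_comp_linXV ?array_f_eq0 //.
set N := _ * (1 + _ + _).
set d := 1 - b *: fpsX.
have ud : d \is a GRing.unit.
  by rewrite fps_unitE !fps_coef0E mulr0 subr0 oner_eq0.
set f := fpsX / _.
have uf : 1 - a *: f \is a GRing.unit.
  by rewrite fps_unitE fps_coefB fps_coefZ array_f_eq0 mulr0 subr0 oner_eq0.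
have -> : quad = d ^+ 2 * (1 - a *: f).
  rewrite mulrBr mulr1 -scalerAr /f mulrCA mulrV ?unitrX // mulr1 quadE /d.
  by rewrite !fps_scaleC; ring.
rewrite exprMn -exprM.
rewrite -mulrA [_ * (d ^+ _ * _)]mulrCA mulVr ?unitrX // mulr1.
by rewrite mulrVK ?unitrX.
Qed.

(** * Comparison of the two recurrences *)

Let coef_Xq3_step n : fps_coef X_quad_inv3 n.+1 =
  ((n%:R + 4) * fps_coef quad_inv2 n
     + 2 * (a + 2 * b) * fps_coef X_quad_inv3 n) / 4.
Proof. by rewrite -coef_Xq3S; field. Qed.

Let coef_q2_step n : fps_coef quad_inv2 n.+1 =
  (2 * (a + 2 * b) * fps_coef X_quad_inv3 n.+1
     - 4 * b ^+ 2 * fps_coef X_quad_inv3 n) / (n%:R + 1).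
Proof. by rewrite -coef_q2S; field; affine_neq0. Qed.

Let coef_q2_0 : fps_coef quad_inv2 0 = 1.
Proof.
by rewrite /quad_inv2 !fps_coef0E !mulr0 subr0 addr0 expr1n invr1.
Qed.

Let coef_Xq3_0 : fps_coef X_quad_inv3 0 = 0.
Proof. exact: fps_coefXM0. Qed.

Lemma riordan_closed0 : riordan_closed 0 = 1.
Proof. by rewrite /riordan_closed coef_q2_0 coef_Xq3_0; field. Qed.

Lemma riordan_closed1 : riordan_closed 1 = sqnorm 0 * (a + b * alpha 0).
Proof.
rewrite /riordan_closed coef_q2_step coef_Xq3_step coef_q2_0 coef_Xq3_0.
by rewrite /sqnorm /alpha; field.
Qed.

(** By the first-order system, all terms are linear combinations of the two
    coefficients of index n, and both combinations agree as rational functions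
    of n, a and b. *)
Lemma riordan_closedSS n :
  riordan_closed n.+2 =
    sqnorm n.+1 * (a + b * alpha n.+1) * riordan_closed n.+1
      - (b * sqnorm n.+1) ^+ 2 * riordan_closed n.
Proof.
rewrite /riordan_closed !coef_q2_step !coef_Xq3_step !coef_q2_step !coef_Xq3_step.
rewrite /sqnorm /alpha -![n.+2%:R]natr1 -![n.+1%:R]natr1; field.
affine_neq0.
Qed.

Lemma det_jacobi n : \det (jacobi alpha sqnorm a b n) = riordan_closed n.
Proof.
pose eq_at m := \det (jacobi alpha sqnorm a b m) = riordan_closed m.
suff H m : eq_at m /\ eq_at m.+1 by case: (H n).
rewrite /eq_at; elim: m => [|m [IHm IHm1]]; split=> //.
- by rewrite det_mx00 riordan_closed0.
- by rewrite det_mx11 tridiag_diag // riordan_closed1.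
- by rewrite det_tridiagSS riordan_closedSS -IHm -IHm1.
Qed.

End Series.

Theorem proposition16 (a b : rat) (n : nat) :
  hankel (fun m : nat => a * catalan (m + 3) + b * catalan (m + 4)) n =
  fps_coef
    (riordan_act
       (@Riordan rat
          ((1 - b ^+ 2 *: fpsX ^+ 2)
             * (1 + (a + 6%:R * b) *: fpsX + b ^+ 2 *: fpsX ^+ 2)
             / (1 - b *: fpsX) ^+ 8)
          (fpsX / (1 - b *: fpsX) ^+ 2)
          (array_g_neq0 a b) (array_f_eq0 b) (array_f'_neq0 b))
       ((1 - a *: fpsX) ^+ 4)^-1)
    n.+1.
Proof.
rewrite (riordan_coef n.+1 (riordan_series a b)) -det_jacobi.
rewrite -(hankel_stieltjes stieltjes0 stieltjesS0 stieltjesSS sqnormS).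
congr (\det _); apply/matrixP => i j; rewrite !mxE.
by rewrite -!catalan_stieltjes addSnnS.
Qed.
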